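(* Let $1\le s\le 4$ be an integer. Then $\widehat{R}_{s/s,2}=2s$. Moreover, the unique function $\psi\in\widehat{\Pi}_{s/s,2}$ with $R(\psi)=2s$ is \[ \psi(z)=\frac{\left(1+\frac{z}{2s}\right)^s}{\left(1-\frac{z}{2s}\right)^s}. \]
   Context: A real rational function $\psi$ is always considered in lowest terms, as a smooth function on $\mathbb{R}$ minus its finitely many poles. It is absolutely monotonic at $x\in\mathbb{R}$ if $x$ is not a pole and $\psi^{(k)}(x)\ge 0$ for all integers $k\ge 0$. The radius of absolute monotonicity is $R(\psi)=\sup\big(\{r\in[0,\infty): \psi \text{ is absolutely monotonic at each point of } [-r,0]\}\cup\{0\}\big)\in[0,+\infty]$. For $m,n,p\in\mathbb{N}$, $\Pi_{m/n,p}$ denotes the set of rational functions $\psi=P/Q$ with $P,Q$ real polynomials, $\deg P\le m$, $Q\not\equiv 0$, $\deg Q\le n$, such that $\psi(z)-e^z=O(z^{p+1})$ as $z\to 0$. The set $\widehat{\Pi}_{m/n,p}$ consists of those $\psi\in\Pi_{m/n,p}$ that can be written as $\psi(z)=P(z)/(1-az)^n$ with $\deg P\le m$ and $a\in\mathbb{R}$. Finally, $\widehat{R}_{m/n,p}=\sup\{R(\psi):\psi\in\widehat{\Pi}_{m/n,p}\}$. *)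

(* Defs.v *)
From Stdlib Require Import Reals List.
Import ListNotations.
Open Scope R_scope.

Definition peval (c : list R) (x : R) : R :=
  fold_right (fun a acc => a + x * acc) 0 c.

Definition poly_deg_le (d : nat) (f : R -> R) : Prop :=
  exists c : list R, (length c <= S d)%nat /\ forall x, f x = peval c x.

(* Absolute monotonicity at x of the rational function P/Q (taken in lowest
   terms): x is not a pole, i.e. P/Q extends smoothly (d 0) to a
   neighbourhood of x, with successive derivatives d k, all nonnegative at x. *)
Definition abs_mono_at (P Q : R -> R) (x : R) : Prop :=
  exists (eps : R) (d : nat -> R -> R),
    0 < eps /\
    (forall y, Rabs (y - x) < eps -> Q y <> 0 -> d 0%nat y = P y / Q y) /\
    (forall (k : nat) y, Rabs (y - x) < eps ->
        derivable_pt_lim (d k) y (d (S k) y)) /\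
    (forall k : nat, 0 <= d k x).

Definition rad_set (P Q : R -> R) (r : R) : Prop :=
  r = 0 \/ (0 <= r /\ forall x, -r <= x <= 0 -> abs_mono_at P Q x).

Definition radius_is (P Q : R -> R) (v : R) : Prop := is_lub (rad_set P Q) v.

Definition in_Pi (m n p : nat) (P Q : R -> R) : Prop :=
  poly_deg_le m P /\ poly_deg_le n Q /\ (exists x, Q x <> 0) /\
  exists C delta, 0 < delta /\
    forall z, 0 < Rabs z < delta -> Q z <> 0 ->
      Rabs (P z / Q z - exp z) <= C * Rabs z ^ (p + 1).

Definition hat_den (n : nat) (a : R) : R -> R := fun z => (1 - a * z) ^ n.

Definition in_Pihat (m n p : nat) (P : R -> R) (a : R) : Prop :=
  poly_deg_le m P /\ in_Pi m n p P (hat_den n a).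

(* hat R_{m/n,p} = v (finite v): sup over hat Pi of R(psi), i.e. the sup of
   the union of the sets rad_set. *)
Definition hatR_is (m n p : nat) (v : R) : Prop :=
  is_lub (fun r => exists P a, in_Pihat m n p P a /\ rad_set P (hat_den n a) r) v.

Definition psi_star (s : nat) (z : R) : R :=
  (1 + z / (2 * INR s)) ^ s / (1 - z / (2 * INR s)) ^ s.

Definition agrees_star (s : nat) (P Q : R -> R) : Prop :=
  forall z, Q z <> 0 -> 1 - z / (2 * INR s) <> 0 -> P z / Q z = psi_star s z.

(* Main.v *)
(* Write [psi] as a polynomial of degree at most [s] in [u = 1/(1 - a z)].  For
   [a < 0] the Taylor coefficients at [0] alternate in sign, and for [a = 0] the
   Taylor expansion at [- 2 s] describes a distribution on [0, ..., s] with mean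
   [2 s]; so [a > 0].  For [0 < rho <= 2 s] put [theta = a rho] and expand [psi] in
   powers of [v = (1 + z/rho)/(1 - a z)], which are generating functions of
   negative binomial laws: the Taylor coefficients at [- rho] become probabilities
   with mean and variance [rho], and the coefficients [e_j] of [v^j], although
   possibly negative, satisfy two moment equations.  For [rho = 2 s] a mean
   argument excludes [theta < 1], and [theta = 1] forces [psi = v^s].  For
   [theta > 1], averaging a quadratic weight with consecutive integer roots gives a
   contradiction unless [theta] is large ([s = 3, 4]); then [rho] is decreased so
   that [theta] is [5] or [3], where finitely many derivatives are incompatible.
   The endpoint [- 2 s] is reached by continuity of the derivatives. *)
Require Import Defs.
From Stdlib Require Import Reals Lra Lia List Factorial.
From Coquelicot Require Import Coquelicot.
Import ListNotations.
Open Scope R_scope.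

(** * Affine substitution in polynomials *)

Lemma peval_affine_cons (al be b : R) (l : list R) :
  exists m, length m = S (length l) /\
    forall x, peval m x = b + (al + be * x) * peval l x.
Proof.
  revert b; induction l as [|h l IH]; intros b.
  - exists [b]; split; [reflexivity|]; intros x; simpl; ring.
  - destruct (IH (be * h)) as [m [Hlen Hm]].
    exists (b + al * h :: m); split; [simpl; now rewrite Hlen|].
    intros x; change (b + al * h + x * peval m x = b + (al + be * x) * (h + x * peval l x)).
    rewrite Hm; ring.
Qed.

Lemma peval_affine (al be : R) (l : list R) :
  exists m, length m = length l /\ forall x, peval m x = peval l (al + be * x).
Proof.
  induction l as [|h l [m [Hlen Hm]]].
  - exists []; split; reflexivity.
  - destruct (peval_affine_cons al be h m) as [m' [Hlen' Hm']].
    exists m'; split; [simpl; congruence|].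
    intros x; rewrite Hm', Hm; reflexivity.
Qed.

(** * Towers of successive derivatives and absolute monotonicity *)

Definition smooth_tower (D : nat -> R -> R) (x eps : R) : Prop :=
  forall k y, Rabs (y - x) < eps -> is_derive (D k) y (D (S k) y).

Lemma Rabs_lt_locally (x eps y : R) :
  Rabs (y - x) < eps -> locally y (fun t => Rabs (t - x) < eps).
Proof.
  intros Hy.
  assert (Hd : 0 < eps - Rabs (y - x)) by lra.
  exists (mkposreal _ Hd); intros t Ht.
  change (Rabs (t - y) < eps - Rabs (y - x)) in Ht.
  replace (t - x) with ((t - y) + (y - x)) by ring.
  pose proof (Rabs_triang (t - y) (y - x)); lra.
Qed.

(** Derivatives are unique on a neighbourhood, so the tower hidden in [abs_mono_at] coincides near
    [x] with any explicit one that starts from [P / Q]. *)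
Lemma abs_mono_at_tower (P Q : R -> R) (D : nat -> R -> R) (x eps : R) :
  0 < eps -> smooth_tower D x eps ->
  (forall y, Rabs (y - x) < eps -> Q y <> 0 /\ D 0%nat y = P y / Q y) ->
  abs_mono_at P Q x <-> (forall k, 0 <= D k x).
Proof.
  intros Heps HD H0; split.
  - intros [eps' [d [Heps' [Hd0 [Hd Hpos]]]]].
    set (e := Rmin eps eps').
    assert (He : 0 < e) by (apply Rmin_glb_lt; assumption).
    assert (Hee : e <= eps) by apply Rmin_l.
    assert (Hee' : e <= eps') by apply Rmin_r.
    assert (Heq : forall k y, Rabs (y - x) < e -> d k y = D k y).
    { induction k as [|k IH]; intros y Hy.
      - destruct (H0 y) as [HQ ->]; [lra|]. apply Hd0; [lra|assumption].
      - assert (H1 : is_derive (d k) y (d (S k) y))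
          by (apply is_derive_Reals, Hd; lra).
        assert (H2 : is_derive (d k) y (D (S k) y)).
        { apply is_derive_ext_loc with (D k).
          - apply filter_imp with (2 := Rabs_lt_locally x e y Hy).
            intros t Ht; symmetry; apply IH, Ht.
          - apply HD; lra. }
        now rewrite <- (is_derive_unique _ _ _ H1), <- (is_derive_unique _ _ _ H2). }
    intros k; rewrite <- Heq; [apply Hpos|].
    rewrite Rminus_diag, Rabs_R0; exact He.
  - intros Hpos; exists eps, D; repeat split; try assumption.
    + intros y Hy _; apply (H0 y Hy).
    + intros k y Hy; apply is_derive_Reals, HD, Hy.
Qed.

Lemma smooth_tower_continuous (D : nat -> R -> R) (x eps : R) (k : nat) :
  0 < eps -> smooth_tower D x eps -> continuous (D k) x.
Proof.
  intros Heps HD; apply (@ex_derive_continuous R_AbsRing R_NormedModule).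
  exists (D (S k) x); apply HD; rewrite Rminus_diag, Rabs_R0; exact Heps.
Qed.

(** * Order conditions at the origin *)

Lemma big_O_antiderivative (f f' : R -> R) (n : nat) (K eps : R) :
  f 0 = 0 ->
  (forall y, Rabs y < eps -> is_derive f y (f' y)) ->
  (forall y, Rabs y < eps -> Rabs (f' y) <= K * Rabs y ^ n) ->
  0 <= K ->
  forall z, Rabs z < eps -> Rabs (f z) <= K * Rabs z ^ S n.
Proof.
  intros Hf0 Hder Hbd HK z Hz.
  assert (Hin : forall t, Rmin 0 z <= t <= Rmax 0 z -> Rabs t <= Rabs z).
  { intros t; unfold Rmin, Rmax, Rabs; repeat destruct Rle_dec;
      repeat destruct Rcase_abs; lra. }
  destruct (MVT_gen f 0 z f') as [t [Ht Heq]].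
  - intros t Ht; apply Hder; pose proof (Hin t); lra.
  - intros t Ht; apply continuity_pt_filterlim.
    apply (@ex_derive_continuous R_AbsRing R_NormedModule).
    exists (f' t); apply Hder; pose proof (Hin t); lra.
  - rewrite Hf0, !Rminus_0_r in Heq; rewrite Heq, Rabs_mult.
    pose proof (Hin t Ht) as Htz.
    assert (H1 : Rabs (f' t) <= K * Rabs z ^ n).
    { eapply Rle_trans; [apply Hbd; lra|].
      apply Rmult_le_compat_l; [assumption|].
      apply pow_incr; split; [apply Rabs_pos|assumption]. }
    simpl; pose proof (Rabs_pos z); nra.
Qed.

Lemma is_derive_sub (f g : R -> R) (y l m v : R) :
  is_derive f y l -> is_derive g y m -> l - m = v ->
  is_derive (fun t => f t - g t) y v.
Proof. intros Hf Hg <-; exact (is_derive_minus f g y l m Hf Hg). Qed.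

(** The third derivative is bounded near 0 by continuity, and three applications of the mean value
    theorem carry the bound down to [D 0]. *)
Lemma taylor_order2 (D : nat -> R -> R) (eps : R) :
  0 < eps -> smooth_tower D 0 eps ->
  exists K delta, 0 < delta <= eps /\ 0 <= K /\
    forall z, Rabs z < delta ->
      Rabs (D 0%nat z - (D 0%nat 0 + D 1%nat 0 * z + D 2%nat 0 / 2 * z ^ 2))
        <= K * Rabs z ^ 3.
Proof.
  intros Heps HD.
  pose proof (smooth_tower_continuous D 0 eps 3 Heps HD) as Hc.
  assert (Hloc : locally 0 (fun y => Rabs (D 3%nat y - D 3%nat 0) < 1)).
  { apply (Hc (fun v => Rabs (v - D 3%nat 0) < 1)).
    exists (mkposreal 1 Rlt_0_1); intros v Hv; exact Hv. }
  destruct Hloc as [d Hd].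
  set (delta := Rmin eps d).
  assert (Hdelta : 0 < delta) by (apply Rmin_glb_lt; [assumption|apply cond_pos]).
  assert (Hde : delta <= eps) by apply Rmin_l.
  assert (Hdd : delta <= d) by apply Rmin_r.
  set (K := Rabs (D 3%nat 0) + 1).
  assert (HK : 0 <= K) by (unfold K; pose proof (Rabs_pos (D 3%nat 0)); lra).
  assert (Hder : forall k y, Rabs y < delta -> is_derive (D k) y (D (S k) y)).
  { intros k y Hy; apply HD; rewrite Rminus_0_r; lra. }
  exists K, delta; split; [lra|split; [assumption|]].
  assert (B3 : forall y, Rabs y < delta -> Rabs (D 3%nat y) <= K * Rabs y ^ 0).
  { intros y Hy.
    assert (H1 : Rabs (D 3%nat y - D 3%nat 0) < 1).
    { apply Hd; change (Rabs (y - 0) < d); rewrite Rminus_0_r; lra. }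
    pose proof (Rabs_triang (D 3%nat y - D 3%nat 0) (D 3%nat 0)) as H2.
    replace (D 3%nat y - D 3%nat 0 + D 3%nat 0) with (D 3%nat y) in H2 by ring.
    unfold K; simpl; lra. }
  assert (B2 : forall y, Rabs y < delta ->
            Rabs (D 2%nat y - D 2%nat 0) <= K * Rabs y ^ 1).
  { apply (big_O_antiderivative (fun y => D 2%nat y - D 2%nat 0) (D 3%nat));
      try assumption; [ring|].
    intros y Hy.
    eapply is_derive_sub; [exact (Hder 2%nat y Hy)|auto_derive; [exact I|reflexivity]|ring]. }
  assert (B1 : forall y, Rabs y < delta ->
            Rabs (D 1%nat y - (D 1%nat 0 + D 2%nat 0 * y)) <= K * Rabs y ^ 2).
  { apply (big_O_antiderivative (fun y => D 1%nat y - (D 1%nat 0 + D 2%nat 0 * y))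
             (fun y => D 2%nat y - D 2%nat 0)); try assumption; [ring|].
    intros y Hy.
    eapply is_derive_sub; [exact (Hder 1%nat y Hy)|auto_derive; [exact I|reflexivity]|ring]. }
  apply (big_O_antiderivative
           (fun y => D 0%nat y - (D 0%nat 0 + D 1%nat 0 * y + D 2%nat 0 / 2 * y ^ 2))
           (fun y => D 1%nat y - (D 1%nat 0 + D 2%nat 0 * y))); try assumption; [ring|].
  intros y Hy.
  eapply is_derive_sub; [exact (Hder 0%nat y Hy)|auto_derive; [exact I|reflexivity]|field].
Qed.

Lemma small_constant (A K delta : R) :
  0 < delta -> (forall h, 0 < h < delta -> Rabs A <= K * h) -> A = 0.
Proof.
  intros Hd H.
  destruct (Req_dec A 0) as [|HA]; [assumption|exfalso].
  pose proof (Rabs_pos_lt A HA) as HA'.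
  set (M := Rabs K + 1).
  assert (HM : 0 < M) by (unfold M; pose proof (Rabs_pos K); lra).
  set (h := Rmin (delta / 2) (Rabs A / (2 * M))).
  assert (Hh : 0 < h).
  { apply Rmin_glb_lt; [lra|apply Rdiv_lt_0_compat; lra]. }
  assert (Hh1 : h <= delta / 2) by apply Rmin_l.
  assert (Hh2 : h <= Rabs A / (2 * M)) by apply Rmin_r.
  assert (Hh3 : M * h <= Rabs A / 2).
  { apply Rle_trans with (M * (Rabs A / (2 * M))).
    - apply Rmult_le_compat_l; lra.
    - right; field; lra. }
  pose proof (H h ltac:(lra)) as H1.
  pose proof (Rle_abs K).
  assert (K * h <= M * h) by (apply Rmult_le_compat_r; unfold M; lra).
  lra.
Qed.

Lemma quadratic_big_O3 (A B C K delta : R) :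
  0 < delta ->
  (forall z, 0 < Rabs z < delta -> Rabs (A + B * z + C * z ^ 2) <= K * Rabs z ^ 3) ->
  A = 0 /\ B = 0 /\ C = 0.
Proof.
  intros Hd H.
  set (d1 := Rmin delta 1).
  assert (Hd1 : 0 < d1) by (apply Rmin_glb_lt; lra).
  assert (Hd2 : d1 <= delta) by apply Rmin_l.
  assert (Hd3 : d1 <= 1) by apply Rmin_r.
  assert (HK : forall h, 0 < h < d1 -> Rabs (A + B * h + C * h ^ 2) <= K * h ^ 3).
  { intros h Hh; pose proof (H h) as H1; rewrite (Rabs_pos_eq h) in H1 by lra.
    apply H1; lra. }
  assert (HKp : 0 <= K).
  { pose proof (HK (d1 / 2) ltac:(lra)) as H1.
    pose proof (Rabs_pos (A + B * (d1 / 2) + C * (d1 / 2) ^ 2)).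
    assert (0 < (d1 / 2) ^ 3) by (apply pow_lt; lra). nra. }
  assert (HA : A = 0).
  { apply small_constant with (K := K + Rabs B + Rabs C) (delta := d1); [assumption|].
    intros h Hh; pose proof (HK h Hh) as H1.
    assert (Rabs (B * h) = Rabs B * h) by (rewrite Rabs_mult, (Rabs_pos_eq h); lra).
    assert (Rabs (C * h ^ 2) = Rabs C * h ^ 2)
      by (rewrite Rabs_mult, (Rabs_pos_eq (h ^ 2)); [reflexivity|nra]).
    replace A with ((A + B * h + C * h ^ 2) + - (B * h) + - (C * h ^ 2)) by ring.
    eapply Rle_trans; [apply Rabs_triang|].
    eapply Rle_trans; [apply Rplus_le_compat_r, Rabs_triang|].
    rewrite !Rabs_Ropp, H0, H2.
    pose proof (Rabs_pos C).
    assert (h ^ 2 <= h) by nra. assert (h ^ 3 <= h) by nra. nra. }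
  assert (HB : B = 0).
  { apply small_constant with (K := K + Rabs C) (delta := d1); [assumption|].
    intros h Hh; pose proof (HK h Hh) as H1; rewrite HA in H1.
    replace (0 + B * h + C * h ^ 2) with (h * (B + C * h)) in H1 by ring.
    rewrite Rabs_mult, (Rabs_pos_eq h) in H1 by lra.
    assert (H2 : Rabs (B + C * h) <= K * h ^ 2).
    { apply Rmult_le_reg_l with h; [lra|]. nra. }
    assert (H3 : Rabs (C * h) = Rabs C * h) by (rewrite Rabs_mult, (Rabs_pos_eq h); lra).
    replace B with ((B + C * h) + - (C * h)) by ring.
    eapply Rle_trans; [apply Rabs_triang|].
    rewrite Rabs_Ropp, H3. assert (h ^ 2 <= h) by nra. nra. }
  repeat split; try assumption.
  apply small_constant with (K := K) (delta := d1); [assumption|].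
  intros h Hh; pose proof (HK h Hh) as H1; rewrite HA, HB in H1.
  replace (0 + 0 * h + C * h ^ 2) with (h ^ 2 * C) in H1 by ring.
  assert (Hh2 : 0 < h ^ 2) by nra.
  rewrite Rabs_mult, (Rabs_pos_eq (h ^ 2)) in H1 by lra.
  apply Rmult_le_reg_l with (h ^ 2); [lra|]. nra.
Qed.

(** Every derivative of [exp] at 0 is 1, and a quadratic of size [O(z^3)] vanishes, so approximation
    of order 2 amounts to three equations at 0. *)
Lemma in_Pi_2_tower (m n : nat) (P Q : R -> R) (D : nat -> R -> R) (eps : R) :
  0 < eps -> smooth_tower D 0 eps ->
  (forall y, Rabs (y - 0) < eps -> Q y <> 0 /\ D 0%nat y = P y / Q y) ->
  in_Pi m n 2 P Q <->
  poly_deg_le m P /\ poly_deg_le n Q /\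
  D 0%nat 0 = 1 /\ D 1%nat 0 = 1 /\ D 2%nat 0 = 1.
Proof.
  intros Heps HD H0.
  set (h := fun k y => D k y - exp y).
  assert (Hh : smooth_tower h 0 eps).
  { intros k y Hy; apply (is_derive_minus (D k) exp); [apply HD, Hy|apply is_derive_exp]. }
  destruct (taylor_order2 h eps Heps Hh) as [K [delta [Hdelta [HK Htay]]]].
  assert (Hbr : forall z, Rabs z < delta -> Q z <> 0 /\ h 0%nat z = P z / Q z - exp z).
  { intros z Hz; unfold h.
    destruct (H0 z) as [HQ ->]; [rewrite Rminus_0_r; lra|]. now split. }
  assert (Hh0 : forall k, h k 0 = D k 0 - 1) by (intros k; unfold h; now rewrite exp_0).
  split.
  - intros [HP [HQ [_ [C [d [Hd HC]]]]]]; split; [assumption|split; [assumption|]].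
    set (d' := Rmin d delta).
    assert (Hd' : 0 < d') by (apply Rmin_glb_lt; lra).
    assert (Hd1 : d' <= d) by apply Rmin_l.
    assert (Hd2 : d' <= delta) by apply Rmin_r.
    destruct (quadratic_big_O3 (h 0%nat 0) (h 1%nat 0) (h 2%nat 0 / 2) (C + K) d' Hd')
      as [E0 [E1 E2]].
    + intros z Hz; pose proof (Htay z ltac:(lra)) as H1.
      destruct (Hbr z ltac:(lra)) as [Hnz Hz0].
      pose proof (HC z ltac:(lra) Hnz) as H2; rewrite <- Hz0 in H2.
      change (2 + 1)%nat with 3%nat in H2.
      set (T := h 0%nat 0 + h 1%nat 0 * z + h 2%nat 0 / 2 * z ^ 2) in *.
      replace T with (h 0%nat z + - (h 0%nat z - T)) by ring.
      eapply Rle_trans; [apply Rabs_triang|]. rewrite Rabs_Ropp; lra.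
    + rewrite Hh0 in E0, E1, E2; lra.
  - intros [HP [HQ [E0 [E1 E2]]]]; split; [assumption|split; [assumption|split]].
    + exists 0; apply H0; rewrite Rminus_0_r, Rabs_R0; exact Heps.
    + exists K, delta; split; [lra|].
      intros z Hz Hnz; destruct (Hbr z ltac:(lra)) as [_ <-].
      pose proof (Htay z ltac:(lra)) as H1.
      rewrite !Hh0, E0, E1, E2 in H1.
      replace (h 0%nat z - (1 - 1 + (1 - 1) * z + (1 - 1) / 2 * z ^ 2))
        with (h 0%nat z) in H1 by field.
      exact H1.
Qed.

(** * Polynomials in [1/(1 - a z)] and their derivatives *)

(** The rising factorial [j (j + 1) ... (j + k - 1)], produced by differentiating [(1 - a y)^(-j)]
    [k] times. *)
Fixpoint rising (j k : nat) : R :=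
  match k with O => 1 | S k => rising j k * INR (j + k) end.

(* The [k]-th derivative of [sum_(j <= 4) c_j (1 - a y)^(-j)]. *)
Definition pfrac (a : R) (c : nat -> R) (k : nat) (y : R) : R :=
  sum_f_R0 (fun j => c j * rising j k * a ^ k * (/ (1 - a * y)) ^ (j + k)) 4.

Lemma is_derive_inv_pow (a : R) (n : nat) (y : R) :
  1 - a * y <> 0 ->
  is_derive (fun t => (/ (1 - a * t)) ^ n) y (INR n * a * (/ (1 - a * y)) ^ S n).
Proof.
  intros Hy.
  assert (H : is_derive (fun t => / (1 - a * t)) y (a * (/ (1 - a * y)) ^ 2)).
  { auto_derive; [assumption|field; assumption]. }
  replace (INR n * a * (/ (1 - a * y)) ^ S n)
    with (INR n * (a * (/ (1 - a * y)) ^ 2) * (/ (1 - a * y)) ^ Nat.pred n)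
    by (destruct n; [simpl; ring|simpl Nat.pred; rewrite <- !tech_pow_Rmult; ring]).
  apply (is_derive_pow (fun t => / (1 - a * t)) n y _ H).
Qed.

Lemma is_derive_pfrac (a : R) (c : nat -> R) (k : nat) (y : R) :
  1 - a * y <> 0 -> is_derive (pfrac a c k) y (pfrac a c (S k) y).
Proof.
  intros Hy; unfold pfrac; generalize 4%nat as N.
  assert (H : forall j, is_derive
     (fun t => c j * rising j k * a ^ k * (/ (1 - a * t)) ^ (j + k)) y
     (c j * rising j (S k) * a ^ S k * (/ (1 - a * y)) ^ (j + S k))).
  { intros j.
    replace (c j * rising j (S k) * a ^ S k * (/ (1 - a * y)) ^ (j + S k))
      with (c j * rising j k * a ^ k * (INR (j + k) * a * (/ (1 - a * y)) ^ S (j + k)))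
      by (rewrite Nat.add_succ_r; cbn [rising pow]; ring).
    apply (is_derive_scal (fun t => (/ (1 - a * t)) ^ (j + k))).
    now apply is_derive_inv_pow. }
  induction N as [|N IH]; [apply H|].
  exact (is_derive_plus _ _ y _ _ IH (H (S N))).
Qed.

Lemma pfrac_tower (a : R) (c : nat -> R) (x : R) :
  0 < 1 - a * x ->
  exists eps, 0 < eps /\ smooth_tower (pfrac a c) x eps /\
    forall y, Rabs (y - x) < eps -> 0 < 1 - a * y.
Proof.
  intros Hx.
  pose proof (Rabs_pos a) as Ha.
  (* Moving by less than [eps] changes [a y] by less than [1 - a x]; the added 1 covers [a = 0]. *)
  set (eps := (1 - a * x) / (Rabs a + 1)).
  assert (Heps : 0 < eps) by (apply Rdiv_lt_0_compat; lra).
  assert (Hpos : forall y, Rabs (y - x) < eps -> 0 < 1 - a * y).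
  { intros y Hy.
    assert (H1 : (Rabs a + 1) * Rabs (y - x) < 1 - a * x).
    { replace (1 - a * x) with ((Rabs a + 1) * eps) by (unfold eps; field; lra).
      apply Rmult_lt_compat_l; lra. }
    pose proof (Rle_abs (a * (y - x))) as H2; rewrite Rabs_mult in H2.
    pose proof (Rabs_pos (y - x)); nra. }
  exists eps; split; [assumption|split; [|assumption]].
  intros k y Hy; apply is_derive_pfrac. pose proof (Hpos y Hy); lra.
Qed.

Lemma partial_fractions (s : nat) (P : R -> R) (a : R) :
  (s <= 4)%nat -> a <> 0 -> poly_deg_le s P ->
  exists c, (forall j, (s < j)%nat -> c j = 0) /\
    forall z, 1 - a * z <> 0 -> P z / hat_den s a z = pfrac a c 0 z.
Proof.
  intros Hs Ha [l0 [Hl0 HP]].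
  destruct (peval_affine (/ a) (- / a) l0) as [l [Hlen Hl]].
  (* With [w = 1 - a z], dividing [w^i] by [w^s] leaves [(1/w)^(s - i)]: the coefficients are read
     in reverse. *)
  exists (fun j => if Nat.leb j s then nth (s - j) l 0 else 0); split.
  { intros j Hj; destruct (Nat.leb_spec j s); [lia|reflexivity]. }
  intros z Hz.
  assert (HPz : P z = peval l (1 - a * z)).
  { rewrite HP, Hl; f_equal; field; assumption. }
  rewrite HPz; unfold hat_den, pfrac.
  set (w := 1 - a * z) in *; clearbody w.
  rewrite <- Hlen in Hl0; clear - Hs Hl0 Hz.
  do 5 (destruct s as [|s];
    [do 6 (try (destruct l as [|? l]; [simpl in *; field; assumption|]; simpl in Hl0; try lia))|]).
  lia.
Qed.

Lemma pfrac_order_values (a : R) (c : nat -> R) :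
  pfrac a c 0 0 = c 0%nat + c 1%nat + c 2%nat + c 3%nat + c 4%nat /\
  pfrac a c 1 0 = a * (c 1%nat + 2 * c 2%nat + 3 * c 3%nat + 4 * c 4%nat) /\
  pfrac a c 2 0 = a ^ 2 * (2 * c 1%nat + 6 * c 2%nat + 12 * c 3%nat + 20 * c 4%nat).
Proof.
  unfold pfrac; rewrite Rmult_0_r, Rminus_0_r, Rinv_1.
  simpl; repeat split; ring.
Qed.

Lemma rising_values (k : nat) :
  rising 0 (S k) = 0 /\
  rising 1 k = INR (fact k) /\
  rising 2 k = INR (fact k) * (INR k + 1) /\
  rising 3 k = INR (fact k) * ((INR k + 1) * (INR k + 2) / 2) /\
  rising 4 k = INR (fact k) * ((INR k + 1) * (INR k + 2) * (INR k + 3) / 6).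
Proof.
  assert (H0 : rising 0 (S k) = 0).
  { induction k as [|k IH]; [simpl; ring|].
    change (rising 0 (S k) * INR (0 + S k) = 0); rewrite IH; ring. }
  split; [exact H0|clear H0].
  induction k as [|k [H1 [H2 [H3 H4]]]]; [simpl; repeat split; field|].
  cbn [rising]; rewrite H1, H2, H3, H4, fact_simpl, mult_INR, !plus_INR, !S_INR.
  simpl INR; repeat split; field.
Qed.

Lemma pfrac_succ (a : R) (c : nat -> R) (k : nat) (y u : R) :
  u = / (1 - a * y) ->
  pfrac a c (S k) y = INR (fact (S k)) * (a * u) ^ S k *
    (c 1%nat * u + c 2%nat * u ^ 2 * (INR k + 2)
     + c 3%nat * u ^ 3 * ((INR k + 2) * (INR k + 3) / 2)
     + c 4%nat * u ^ 4 * ((INR k + 2) * (INR k + 3) * (INR k + 4) / 6)).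
Proof.
  intros ->; unfold pfrac; cbn [sum_f_R0].
  destruct (rising_values (S k)) as [_ [-> [-> [-> ->]]]].
  destruct (rising_values k) as [-> _].
  generalize (/ (1 - a * y)); intros u.
  rewrite !pow_add, Rpow_mult_distr, S_INR; field.
Qed.

(** * Leading coefficients of polynomials nonnegative on the integers *)

(** If [K < 0], the cubic term outweighs the rest at any [n] beyond [S / - K + 1]; the added 1 gives
    [n > 1], so that lower powers are at most [n ^ 2]. *)
Lemma cubic_leading_nonneg (A B C K : R) :
  (forall n : nat, 0 <= A + B * INR n + C * INR n ^ 2 + K * INR n ^ 3) -> 0 <= K.
Proof.
  intros H; apply Rnot_lt_le; intros HK.
  set (S := Rabs A + Rabs B + Rabs C).
  pose proof (Rabs_pos A) as PA; pose proof (Rabs_pos B) as PB.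
  pose proof (Rabs_pos C) as PC.
  destruct (INR_unbounded (S / - K + 1)) as [n Hn].
  assert (HS : 0 <= S / - K).
  { apply Rmult_le_pos; [unfold S; lra|left; apply Rinv_0_lt_compat; lra]. }
  assert (HSn : S < - K * INR n).
  { replace S with (- K * (S / - K)) by (field; lra).
    apply Rmult_lt_compat_l; lra. }
  pose proof (H n) as Hp; assert (HSp : 0 <= S / - K + 1) by lra.
  assert (Hx : 1 < INR n) by lra.
  set (x := INR n) in *; clearbody x.
  pose proof (Rle_abs A) as LA; pose proof (Rle_abs B) as LB.
  pose proof (Rle_abs C) as LC.
  assert (Hx2 : x <= x ^ 2) by nra.
  assert (F1 : Rabs A * 1 <= Rabs A * x ^ 2) by (apply Rmult_le_compat_l; lra).
  assert (F2 : B * x <= Rabs B * x) by (apply Rmult_le_compat_r; lra).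
  assert (F3 : Rabs B * x <= Rabs B * x ^ 2) by (apply Rmult_le_compat_l; lra).
  assert (F4 : C * x ^ 2 <= Rabs C * x ^ 2) by (apply Rmult_le_compat_r; lra).
  assert (F5 : S * x ^ 2 < - K * x * x ^ 2) by (apply Rmult_lt_compat_r; lra).
  replace (- K * x * x ^ 2) with (- (K * x ^ 3)) in F5 by ring.
  unfold S in F5; lra.
Qed.

Lemma quadratic_leading_nonneg (A B C : R) :
  (forall n : nat, 0 <= A + B * INR n + C * INR n ^ 2) -> 0 <= C.
Proof.
  intros H; apply (cubic_leading_nonneg 0 A B C); intros n.
  replace (0 + A * INR n + B * INR n ^ 2 + C * INR n ^ 3)
    with (INR n * (A + B * INR n + C * INR n ^ 2)) by ring.
  apply Rmult_le_pos; [apply pos_INR|apply H].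
Qed.

(** * Moment conditions from the expansion at [- rho] *)

Definition order2 (a : R) (c : nat -> R) : Prop :=
  pfrac a c 0 0 = 1 /\ pfrac a c 1 0 = 1 /\ pfrac a c 2 0 = 1.

(* With [v = (1 + z/rho)/(1 - a z)] and [theta = a rho] one has
   [1/(1 - a z) = (1 + theta v)/(1 + theta)]; the [e_j] are the coefficients of
   [psi] in powers of [v].  As [v(0) = 1], the order conditions become moment
   conditions on the [e_j].  The last clause says that the derivatives of
   order [n + 1] at [- rho] are nonnegative. *)
Record mixture (theta rho e1 e2 e3 e4 : R) : Prop := Mixture {
  mix_mass : e1 + e2 + e3 + e4 <= 1;
  mix_mean : (1 + theta) * (e1 + 2 * e2 + 3 * e3 + 4 * e4) = rho;
  mix_square : (1 + theta) * (e1 + 4 * e2 + 9 * e3 + 16 * e4)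
    = (rho + 1 - theta) * (e1 + 2 * e2 + 3 * e3 + 4 * e4);
  mix_pos : forall n : nat,
    0 <= theta ^ 3 * e1 + INR n * theta ^ 2 * e2
         + INR n * (INR n - 1) / 2 * theta * e3
         + INR n * (INR n - 1) * (INR n - 2) / 6 * e4 }.

(** Since [1/(1 - a z) = / (1 + theta) + q v], the four weights are the coefficients of
    [v, ..., v^4] after binomial expansion. The coefficient of [v^0] is [psi(- rho)], and its sign
    gives the mass bound. *)
Lemma mixture_of_pfrac (a rho : R) (c : nat -> R) (q : R) :
  0 < a -> 0 < rho -> q = a * rho / (1 + a * rho) ->
  order2 a c -> (forall k, 0 <= pfrac a c k (- rho)) ->
  mixture (a * rho) rho
    (q * c 1%nat + 2 * q * / (1 + a * rho) * c 2%nat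
      + 3 * q * (/ (1 + a * rho)) ^ 2 * c 3%nat + 4 * q * (/ (1 + a * rho)) ^ 3 * c 4%nat)
    (q ^ 2 * c 2%nat + 3 * q ^ 2 * / (1 + a * rho) * c 3%nat
      + 6 * q ^ 2 * (/ (1 + a * rho)) ^ 2 * c 4%nat)
    (q ^ 3 * c 3%nat + 4 * q ^ 3 * / (1 + a * rho) * c 4%nat)
    (q ^ 4 * c 4%nat).
Proof.
  intros Ha Hr Hq [O0 [O1 O2]] Hpos.
  destruct (pfrac_order_values a c) as [E0 [E1 E2]].
  rewrite E0 in O0; rewrite E1 in O1; rewrite E2 in O2; clear E0 E1 E2.
  assert (Hth : 0 < a * rho) by (apply Rmult_lt_0_compat; assumption).
  assert (HS1 : c 1%nat + 2 * c 2%nat + 3 * c 3%nat + 4 * c 4%nat = / a).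
  { apply Rmult_eq_reg_l with a; [rewrite O1; field; lra|lra]. }
  assert (HS2 : c 2%nat + 3 * c 3%nat + 6 * c 4%nat = (/ a ^ 2 - 2 * / a) / 2).
  { rewrite <- HS1; apply Rmult_eq_reg_l with (2 * a ^ 2); [|nra].
    replace (2 * a ^ 2 * _) with (a ^ 2 *
      (2 * c 1%nat + 6 * c 2%nat + 12 * c 3%nat + 20 * c 4%nat)
      - 2 * a ^ 2 * (c 1%nat + 2 * c 2%nat + 3 * c 3%nat + 4 * c 4%nat)) by ring.
    rewrite O2, HS1; field; lra. }
  assert (Hc1 : c 1%nat = / a - 2 * c 2%nat - 3 * c 3%nat - 4 * c 4%nat) by lra.
  assert (Hc2 : c 2%nat = (/ a ^ 2 - 2 * / a) / 2 - 3 * c 3%nat - 6 * c 4%nat) by lra.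
  set (W := 1 + a * rho) in *.
  assert (HW : 1 < W) by (unfold W; lra).
  assert (Hu : / W = / (1 - a * - rho)) by (unfold W; f_equal; ring).
  assert (Huq : / W = 1 - q) by (rewrite Hq; unfold W; field; unfold W in *; lra).
  constructor.
  - pose proof (Hpos 0%nat) as H0; unfold pfrac in H0; rewrite <- Hu in H0.
    simpl in H0; rewrite Huq in H0 |- *.
    match type of H0 with 0 <= ?X =>
      match goal with |- ?Y <= 1 =>
        assert (E : Y = c 0%nat + c 1%nat + c 2%nat + c 3%nat + c 4%nat - X) by ring
      end
    end.
    lra.
  - rewrite Hc1, Hc2, Huq, Hq. unfold W; field. unfold W in *; lra.
  - rewrite Hc1, Hc2, Huq, Hq. unfold W; field. unfold W in *; lra.
  - intros n; pose proof (Hpos (S n)) as H0.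
    rewrite (pfrac_succ a c n _ _ Hu) in H0.
    assert (Hf : 0 < INR (fact (S n)) * (a * / W) ^ S n).
    { apply Rmult_lt_0_compat; [apply INR_fact_lt_0|].
      apply pow_lt, Rmult_lt_0_compat; [assumption|apply Rinv_0_lt_compat; lra]. }
    match type of H0 with 0 <= _ * ?X => assert (HX : 0 <= X) end.
    { apply Rmult_le_reg_l with (1 := Hf); rewrite Rmult_0_r; exact H0. }
    clear H0.
    (* The factor [theta^4] clears the [theta^(-j)] in the coefficient of [(z + rho)^(n + 1)] in
       [v^j]. *)
    replace (_ + _ + _ + _) with ((a * rho) ^ 4 *
        (c 1%nat * / W + c 2%nat * (/ W) ^ 2 * (INR n + 2)
     + c 3%nat * (/ W) ^ 3 * ((INR n + 2) * (INR n + 3) / 2)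
     + c 4%nat * (/ W) ^ 4 * ((INR n + 2) * (INR n + 3) * (INR n + 4) / 6))).
    + apply Rmult_le_pos; [apply pow_le; lra|exact HX].
    + rewrite Hq; fold W; field; lra.
Qed.

(** * Inequalities for the weights *)

(** The cases [n = 0, 1, 2] of positivity; they stand in for the signs of [e2] and [e3], which are
    not known individually. *)
Lemma mixture_head (theta rho e1 e2 e3 e4 : R) :
  0 < theta -> mixture theta rho e1 e2 e3 e4 ->
  0 <= e1 /\ 0 <= theta * e1 + e2 /\ 0 <= theta ^ 2 * e1 + 2 * theta * e2 + e3.
Proof.
  intros Ht [_ _ _ H].
  pose proof (H 0%nat) as H0; pose proof (H 1%nat) as H1; pose proof (H 2%nat) as H2.
  simpl INR in *; clear H.
  repeat split.
  - apply Rmult_le_reg_l with (theta ^ 3); [apply pow_lt; assumption|lra].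
  - apply Rmult_le_reg_l with (theta ^ 2); [apply pow_lt; assumption|lra].
  - apply Rmult_le_reg_l with theta; [assumption|lra].
Qed.

(** As a polynomial in [n], the positivity condition has leading coefficient [e4 / 6]. The next two
    lemmas read off the last weight in lower degrees in the same way. *)
Lemma mixture_last4 (theta rho e1 e2 e3 e4 : R) :
  mixture theta rho e1 e2 e3 e4 -> 0 <= e4.
Proof.
  intros [_ _ _ H].
  apply Rmult_le_reg_l with (/ 6); [lra|]; rewrite Rmult_0_r.
  apply (cubic_leading_nonneg (theta ^ 3 * e1)
    (theta ^ 2 * e2 - theta * e3 / 2 + e4 / 3) (theta * e3 / 2 - e4 / 2)).
  intros n; eapply Rle_trans; [apply (H n)|right; field].
Qed.

Lemma mixture_last3 (theta rho e1 e2 e3 : R) :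
  0 < theta -> mixture theta rho e1 e2 e3 0 -> 0 <= e3.
Proof.
  intros Ht [_ _ _ H].
  apply Rmult_le_reg_l with (theta / 2); [lra|]; rewrite Rmult_0_r.
  apply (quadratic_leading_nonneg (theta ^ 3 * e1)
    (theta ^ 2 * e2 - theta * e3 / 2)).
  intros n; eapply Rle_trans; [apply (H n)|right; field].
Qed.

Lemma mixture_last2 (theta rho e1 e2 : R) :
  0 < theta -> mixture theta rho e1 e2 0 0 -> 0 <= e2.
Proof.
  intros Ht [_ _ _ H].
  apply Rmult_le_reg_l with (theta ^ 2); [apply pow_lt; assumption|]; rewrite Rmult_0_r.
  apply (quadratic_leading_nonneg 0 (theta ^ 3 * e1)).
  intros n; eapply Rle_trans; [|right].
  - apply Rmult_le_pos with (r1 := INR n); [apply pos_INR|apply (H n)].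
  - field.
Qed.

(* [sum (s - j) e_j] would be negative, because the mean exceeds [s]. *)
Lemma mixture_theta_ge1 (s : nat) (theta e1 e2 e3 e4 : R) :
  (1 <= s <= 4)%nat -> 0 < theta -> mixture theta (2 * INR s) e1 e2 e3 e4 ->
  ((s < 2)%nat -> e2 = 0) -> ((s < 3)%nat -> e3 = 0) -> ((s < 4)%nat -> e4 = 0) ->
  1 <= theta.
Proof.
  intros Hs Ht Hm Z2 Z3 Z4; apply Rnot_lt_le; intros Hlt.
  destruct (mixture_head _ _ _ _ _ _ Ht Hm) as [P1 [P2 P3]].
  destruct Hm as [M0 M1 _ _].
  assert (Hy : INR s < e1 + 2 * e2 + 3 * e3 + 4 * e4).
  { apply Rmult_lt_reg_l with (1 + theta); [lra|]. rewrite M1.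
    assert (0 < INR s) by (apply lt_0_INR; lia). nra. }
  destruct s as [|[|[|[|[|s]]]]]; try lia; simpl INR in Hy.
  - rewrite Z2, Z3, Z4 in * by lia; lra.
  - rewrite Z3, Z4 in * by lia; lra.
  - rewrite Z4 in * by lia. assert (theta * e1 <= e1) by nra. lra.
  (* The sum [3 e1 + 2 e2 + e3] equals the quantity in [P3] plus [2 (1 - theta) (theta e1 + e2) + (1
     - theta)^2 e1 + 2 e1], hence is nonnegative. *)
  - assert (H1 : 0 <= (1 - theta) * (theta * e1 + e2)) by (apply Rmult_le_pos; lra).
    assert (H2 : 0 <= (1 - theta) * e1) by (apply Rmult_le_pos; lra).
    assert (H3 : 0 <= (1 - theta) ^ 2 * e1) by (apply Rmult_le_pos; [apply pow2_ge_0|lra]).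
    lra.
Qed.

(** The mean is [s], so the sum of [(s - j) e_j] is [s] times the mass minus [s], at most 0; the
    head inequalities make it nonnegative. Thus the mass is 1, and for [s = 4] the second moment
    separates [e2] from [e3]. *)
Lemma mixture_theta_eq1 (s : nat) (e1 e2 e3 e4 : R) :
  (1 <= s <= 4)%nat -> mixture 1 (2 * INR s) e1 e2 e3 e4 ->
  ((s < 2)%nat -> e2 = 0) -> ((s < 3)%nat -> e3 = 0) -> ((s < 4)%nat -> e4 = 0) ->
  match s with
  | 1%nat => e1 = 1
  | 2%nat => e1 = 0 /\ e2 = 1
  | 3%nat => e1 = 0 /\ e2 = 0 /\ e3 = 1
  | _ => e1 = 0 /\ e2 = 0 /\ e3 = 0 /\ e4 = 1
  end.
Proof.
  intros Hs Hm Z2 Z3 Z4.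
  destruct (mixture_head _ _ _ _ _ _ Rlt_0_1 Hm) as [P1 [P2 P3]].
  destruct Hm as [M0 M1 M2 _].
  destruct s as [|[|[|[|[|s]]]]]; try lia; simpl INR in *.
  - rewrite Z2, Z3, Z4 in * by lia; lra.
  - rewrite Z3, Z4 in * by lia.
    replace (e1 + 2 * e2 + 3 * 0 + 4 * 0) with 2 in M2 by lra; lra.
  - rewrite Z4 in * by lia.
    replace (e1 + 2 * e2 + 3 * e3 + 4 * 0) with 3 in M2 by lra; lra.
  - replace (e1 + 2 * e2 + 3 * e3 + 4 * e4) with 4 in M2 by lra; lra.
Qed.

(** Average [(j - n)(j - n - 1)] over the weights. The missing mass sits at [j = 0], where this is
    nonnegative, and is dropped. The second moment is [y^2 - (theta - 1)/(theta + 1) y], so the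
    formal variance is negative for [theta > 1]. *)
Lemma mixture_quadratic_weight (theta rho e1 e2 e3 e4 n : R) :
  0 < theta -> 0 <= n -> mixture theta rho e1 e2 e3 e4 ->
  let y := e1 + 2 * e2 + 3 * e3 + 4 * e4 in
  (1 - n) * (1 - n - 1) * e1 + (2 - n) * (2 - n - 1) * e2
  + (3 - n) * (3 - n - 1) * e3 + (4 - n) * (4 - n - 1) * e4
  <= (y - n) * (y - n - 1) - (theta - 1) / (theta + 1) * y.
Proof.
  intros Ht Hn [M0 M1 M2 _] y; fold y in M1, M2.
  assert (H2 : e1 + 4 * e2 + 9 * e3 + 16 * e4 = y * y - (theta - 1) / (theta + 1) * y).
  { apply Rmult_eq_reg_l with (1 + theta); [|lra].
    rewrite M2, <- M1; field; lra. }
  assert (H3 : n * (n + 1) * (e1 + e2 + e3 + e4) <= n * (n + 1) * 1)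
    by (apply Rmult_le_compat_l; nra).
  unfold y in *; lra.
Qed.

(** * Excluding [theta > 1], degree by degree *)

Lemma mixture_degree1 (theta e1 : R) :
  0 < theta -> mixture theta 2 e1 0 0 0 -> theta = 1.
Proof.
  intros Ht [M0 M1 M2 _]; nra.
Qed.

(** Choose [n] with [n <= y < n + 1]: the right side of the weight inequality is then negative and
    the left side nonnegative. Degrees 3 and 4 repeat this, with the upper bound on [theta] keeping
    [y] at least 1 or 2. *)
Lemma mixture_degree2 (theta e1 e2 : R) :
  1 < theta -> ~ mixture theta 4 e1 e2 0 0.
Proof.
  intros Ht Hm.
  assert (Ht0 : 0 < theta) by lra.
  destruct (mixture_head _ _ _ _ _ _ Ht0 Hm) as [P1 [P2 _]].
  pose proof (mixture_last2 _ _ _ _ Ht0 Hm) as L.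
  pose proof (mixture_quadratic_weight _ _ _ _ _ _ 1 Ht0 ltac:(lra) Hm) as W1.
  pose proof (mixture_quadratic_weight _ _ _ _ _ _ 0 Ht0 ltac:(lra) Hm) as W0.
  cbv zeta in *.
  destruct Hm as [_ M1 _ _].
  set (y := e1 + 2 * e2 + 3 * 0 + 4 * 0) in *.
  assert (Hd : 0 < (theta - 1) / (theta + 1)) by (apply Rdiv_lt_0_compat; lra).
  assert (Hy : 0 < y < 2) by nra.
  assert (Hdy : 0 < (theta - 1) / (theta + 1) * y) by nra.
  destruct (Rlt_le_dec y 1) as [Hy1|Hy1].
  - assert (y * (y - 1) < 0) by nra. lra.
  - assert ((y - 1) * (y - 2) <= 0) by nra. lra.
Qed.

Lemma mixture_degree3 (theta e1 e2 e3 : R) :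
  1 < theta <= 5 -> ~ mixture theta 6 e1 e2 e3 0.
Proof.
  intros Ht Hm.
  assert (Ht0 : 0 < theta) by lra.
  destruct (mixture_head _ _ _ _ _ _ Ht0 Hm) as [P1 [P2 _]].
  pose proof (mixture_last3 _ _ _ _ _ Ht0 Hm) as L.
  pose proof (mixture_quadratic_weight _ _ _ _ _ _ 2 Ht0 ltac:(lra) Hm) as W2.
  pose proof (mixture_quadratic_weight _ _ _ _ _ _ 1 Ht0 ltac:(lra) Hm) as W1.
  cbv zeta in *.
  destruct Hm as [_ M1 _ _].
  set (y := e1 + 2 * e2 + 3 * e3 + 4 * 0) in *.
  assert (Hd : 0 < (theta - 1) / (theta + 1)) by (apply Rdiv_lt_0_compat; lra).
  assert (Hy : 1 <= y < 3) by nra.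
  assert (Hdy : 0 < (theta - 1) / (theta + 1) * y) by nra.
  destruct (Rlt_le_dec y 2) as [Hy1|Hy1].
  - assert ((y - 1) * (y - 2) <= 0) by nra. lra.
  - assert ((y - 2) * (y - 3) <= 0) by nra. lra.
Qed.

Lemma mixture_degree3_large (rho e1 e2 e3 : R) :
  0 < rho < 6 -> ~ mixture 5 rho e1 e2 e3 0.
Proof.
  intros Hr Hm.
  destruct Hm as [M0 M1 M2 P].
  (* For [n = 25] the free [e3] cancels after substituting the moments, leaving
     [187.5 y (y - 1) >= 0], impossible for [0 < y < 1]. *)
  pose proof (P 25%nat) as P25; clear P; simpl INR in P25.
  set (y := e1 + 2 * e2 + 3 * e3 + 4 * 0) in *.
  assert (Hy : rho = 6 * y) by lra; subst rho.
  assert (He2 : e2 = ((y * y - 2 / 3 * y) - y) / 2 - 3 * e3) by (unfold y in *; lra).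
  assert (He1 : e1 = y - 2 * e2 - 3 * e3) by (unfold y in *; lra).
  rewrite He1, He2 in P25.
  assert (y * (y - 1) < 0) by nra. lra.
Qed.

Lemma mixture_degree4 (theta e1 e2 e3 e4 : R) :
  1 < theta <= 3 -> ~ mixture theta 8 e1 e2 e3 e4.
Proof.
  intros Ht Hm.
  assert (Ht0 : 0 < theta) by lra.
  destruct (mixture_head _ _ _ _ _ _ Ht0 Hm) as [P1 [P2 _]].
  pose proof (mixture_last4 _ _ _ _ _ _ Hm) as L.
  pose proof (mixture_quadratic_weight _ _ _ _ _ _ 3 Ht0 ltac:(lra) Hm) as W3.
  pose proof (mixture_quadratic_weight _ _ _ _ _ _ 2 Ht0 ltac:(lra) Hm) as W2.
  cbv zeta in *.
  destruct Hm as [_ M1 _ _].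
  set (y := e1 + 2 * e2 + 3 * e3 + 4 * e4) in *.
  assert (Hd : 0 < (theta - 1) / (theta + 1)) by (apply Rdiv_lt_0_compat; lra).
  assert (Hy : 2 <= y < 4) by nra.
  assert (Hdy : 0 < (theta - 1) / (theta + 1) * y) by nra.
  destruct (Rlt_le_dec y 3) as [Hy1|Hy1].
  - assert ((y - 2) * (y - 3) <= 0) by nra. lra.
  - assert ((y - 3) * (y - 4) <= 0) by nra.
    (* The left side for [n = 3] is [2 (3 e1 + e2)]; comparing it with [theta e1 + e2 >= 0] needs
       [theta <= 3]. *)
    assert (theta * e1 <= 3 * e1) by nra. lra.
Qed.

(* The moment conditions determine [e1] and [e2]; the free [e3] and [e4] are
   eliminated by [e4 >= 0] and [n = 0, 15] for small [y], by the mass bound and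
   [n = 21, 22] for middle [y], by the mass bound, [e4 >= 0] and [n = 0] for
   large [y]. *)
Lemma mixture_degree4_large (rho e1 e2 e3 e4 : R) :
  0 < rho < 8 -> ~ mixture 3 rho e1 e2 e3 e4.
Proof.
  intros Hr Hm.
  pose proof (mixture_last4 _ _ _ _ _ _ Hm) as L.
  destruct Hm as [M0 M1 M2 P].
  pose proof (P 0%nat) as P0; pose proof (P 15%nat) as P15.
  pose proof (P 21%nat) as P21; pose proof (P 22%nat) as P22.
  clear P; simpl INR in *.
  set (y := e1 + 2 * e2 + 3 * e3 + 4 * e4) in *.
  assert (Hy : rho = 4 * y) by lra; subst rho.
  assert (He2 : e2 = ((y * y - / 2 * y) - y) / 2 - 3 * e3 - 6 * e4) by (unfold y in *; lra).
  assert (He1 : e1 = y - 2 * e2 - 3 * e3 - 4 * e4) by (unfold y in *; lra).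
  clearbody y; subst e1; subst e2.
  destruct (Rlt_le_dec y (13 / 20)) as [Hy1|Hy1].
  (* This is [81 P15 + 9 P0], in which [e3] cancels and [e4] keeps a negative coefficient; its
     nonzero root is 7/10. *)
  - assert (y * (3037.5 * y - 2126.25) < 0) by nra. lra.
  - destruct (Rlt_le_dec y (17 / 10)) as [Hy2|Hy2].
    (* Adding [7 P21 + 5 P22] to 1908 times the mass deficit cancels [e3] and [e4]; the remaining
       quadratic in [y] is negative on this range. *)
    + assert ((y - 13 / 20) * (y - 17 / 10) <= 0) by nra. lra.
    (* Three times the mass deficit plus [e1] equals [(y - 3/2)(y - 4)/2 - e4]. *)
    + assert ((y - 3 / 2) * (y - 4) < 0) by nra. lra.
Qed.

(** * Transfer to rational functions; negative poles *)

Lemma nonneg_left_endpoint (f : R -> R) (b : R) :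
  0 < b -> continuous f (- b) -> (forall x, - b < x <= 0 -> 0 <= f x) -> 0 <= f (- b).
Proof.
  intros Hb Hc H; apply Rnot_lt_le; intros Hneg.
  assert (Hloc : locally (- b) (fun x => f x < 0)).
  { apply (Hc (fun v => v < 0)), (open_lt 0), Hneg. }
  destruct Hloc as [d Hd].
  set (h := Rmin (d / 2) b).
  assert (Hh : 0 < h) by (apply Rmin_glb_lt; [pose proof (cond_pos d); lra|lra]).
  assert (Hh1 : h <= d / 2) by apply Rmin_l.
  assert (Hh2 : h <= b) by apply Rmin_r.
  assert (H1 : f (- b + h) < 0).
  { apply Hd; change (Rabs (- b + h - - b) < d).
    replace (- b + h - - b) with h by ring. rewrite Rabs_pos_eq; lra. }
  pose proof (H (- b + h) ltac:(lra)); lra.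
Qed.

Lemma hat_den_neq0 (s : nat) (a z : R) : 1 - a * z <> 0 -> hat_den s a z <> 0.
Proof. apply pow_nonzero. Qed.

Lemma abs_mono_at_pfrac (s : nat) (P : R -> R) (a : R) (c : nat -> R) (x : R) :
  (forall z, 1 - a * z <> 0 -> P z / hat_den s a z = pfrac a c 0 z) ->
  0 < 1 - a * x ->
  abs_mono_at P (hat_den s a) x <-> (forall k, 0 <= pfrac a c k x).
Proof.
  intros HP Hx; destruct (pfrac_tower a c x Hx) as [eps [He [Ht Hpos]]].
  apply abs_mono_at_tower with eps; try assumption.
  intros y Hy; pose proof (Hpos y Hy).
  split; [apply hat_den_neq0; lra|symmetry; apply HP; lra].
Qed.

Lemma in_Pi_pfrac (m s : nat) (P : R -> R) (a : R) (c : nat -> R) :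
  (forall z, 1 - a * z <> 0 -> P z / hat_den s a z = pfrac a c 0 z) ->
  in_Pi m s 2 P (hat_den s a) <->
  poly_deg_le m P /\ poly_deg_le s (hat_den s a) /\ order2 a c.
Proof.
  intros HP; destruct (pfrac_tower a c 0 ltac:(lra)) as [eps [He [Ht Hpos]]].
  apply in_Pi_2_tower with eps; try assumption.
  intros y Hy; pose proof (Hpos y Hy).
  split; [apply hat_den_neq0; lra|symmetry; apply HP; lra].
Qed.

(* The fourth difference of a cubic vanishes, so its values at 1, ..., 5 cannot
   alternate in sign unless they are zero. *)
Lemma negative_pole_not_abs_mono (a : R) (c : nat -> R) :
  a < 0 -> order2 a c -> ~ (forall k, 0 <= pfrac a c k 0).
Proof.
  intros Ha [_ [O1 _]] Hpos.
  destruct (pfrac_order_values a c) as [_ [E1 _]]; rewrite E1 in O1; clear E1.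
  assert (Hk : forall k, 0 <= a ^ S k * (c 1%nat + c 2%nat * (INR k + 2)
     + c 3%nat * ((INR k + 2) * (INR k + 3) / 2)
     + c 4%nat * ((INR k + 2) * (INR k + 3) * (INR k + 4) / 6))).
  { intros k; pose proof (Hpos (S k)) as H.
    rewrite (pfrac_succ a c k 0 1) in H by (field; lra).
    apply Rmult_le_reg_l with (1 := INR_fact_lt_0 (S k)).
    rewrite Rmult_0_r, <- Rmult_assoc.
    rewrite !pow1, !Rmult_1_r in H; exact H. }
  assert (Hodd : forall n X, (forall k, 0 < (a ^ 2) ^ k) ->
            0 <= a ^ S (2 * n) * X -> X <= 0).
  { intros n X Hp H; rewrite <- tech_pow_Rmult, pow_mult in H.
    pose proof (Hp n). apply Rnot_lt_le; intros HX.
    assert (0 < (a ^ 2) ^ n * X) by (apply Rmult_lt_0_compat; assumption). nra. }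
  assert (Heven : forall n X, (forall k, 0 < (a ^ 2) ^ k) ->
            0 <= a ^ (2 * n) * X -> 0 <= X).
  { intros n X Hp H; rewrite pow_mult in H.
    apply Rmult_le_reg_l with (1 := Hp n); lra. }
  assert (Ha2 : forall k, 0 < (a ^ 2) ^ k) by (intros k; apply pow_lt; nra).
  pose proof (Hodd 0%nat _ Ha2 (Hk 0%nat)) as S1.
  pose proof (Heven 1%nat _ Ha2 (Hk 1%nat)) as S2.
  pose proof (Hodd 1%nat _ Ha2 (Hk 2%nat)) as S3.
  pose proof (Heven 2%nat _ Ha2 (Hk 3%nat)) as S4.
  pose proof (Hodd 2%nat _ Ha2 (Hk 4%nat)) as S5.
  simpl INR in *.
  (* In [S1 - 4 S2 + 6 S3 - 4 S4 + S5 = 0] all terms have the same sign, so each vanishes; the first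
     is [psi'(0) / a]. *)
  assert (Hz : c 1%nat + 2 * c 2%nat + 3 * c 3%nat + 4 * c 4%nat = 0) by lra.
  rewrite Hz in O1; lra.
Qed.

(** * The polynomial case [a = 0] *)

(** The falling factorial; truncated subtraction makes it vanish once [k > i], as the derivative of
    a power should. *)
Fixpoint falling (i k : nat) : R :=
  match k with O => 1 | S k => falling i k * INR (i - k) end.

(* The [k]-th derivative of [sum_(i <= 4) al_i (y + b)^i]. *)
Definition shifted_poly (b : R) (al : nat -> R) (k : nat) (y : R) : R :=
  sum_f_R0 (fun i => al i * falling i k * (y + b) ^ (i - k)) 4.

Lemma is_derive_shifted_poly (b : R) (al : nat -> R) (k : nat) (y : R) :
  is_derive (shifted_poly b al k) y (shifted_poly b al (S k) y).
Proof.
  unfold shifted_poly; generalize 4%nat as N.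
  assert (H : forall i, is_derive (fun t => al i * falling i k * (t + b) ^ (i - k)) y
            (al i * falling i (S k) * (y + b) ^ (i - S k))).
  { intros i.
    replace (al i * falling i (S k) * (y + b) ^ (i - S k))
      with (al i * falling i k * (INR (i - k) * 1 * (y + b) ^ Nat.pred (i - k)))
      by (cbn [falling]; rewrite Nat.sub_succ_r; ring).
    apply (is_derive_scal (fun t => (t + b) ^ (i - k))).
    apply (is_derive_pow (fun t => t + b)).
    auto_derive; [exact I|reflexivity]. }
  induction N as [|N IH]; [apply H|].
  exact (is_derive_plus _ _ y _ _ IH (H (S N))).
Qed.

Lemma shifted_poly_exists (s : nat) (P : R -> R) (b : R) :
  (s <= 4)%nat -> poly_deg_le s P ->
  exists al, (forall i, (s < i)%nat -> al i = 0) /\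
    forall z, P z = shifted_poly b al 0 z.
Proof.
  intros Hs [l0 [Hl0 HP]].
  destruct (peval_affine (- b) 1 l0) as [l [Hlen Hl]].
  exists (fun i => nth i l 0); split.
  { intros i Hi; apply nth_overflow; lia. }
  intros z; rewrite HP.
  replace (peval l0 z) with (peval l (z + b)) by (rewrite Hl; f_equal; ring).
  unfold shifted_poly; rewrite <- Hlen in Hl0.
  do 6 (try (destruct l as [|? l]; [simpl in *; ring|]; simpl in Hl0; try lia)).
Qed.

Lemma polynomial_radius (s : nat) (P : R -> R) :
  (1 <= s <= 4)%nat -> in_Pihat s s 2 P 0 ->
  ~ (forall x, - (2 * INR s) < x <= 0 -> abs_mono_at P (hat_den s 0) x).
Proof.
  intros Hs [HP HPi] Hmono.
  set (b := 2 * INR s) in *.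
  assert (Hs1 : 1 <= INR s) by (apply (le_INR 1); lia).
  destruct (shifted_poly_exists s P b ltac:(lia) HP) as [al [Hal HPal]].
  assert (HQ : forall y, hat_den s 0 y <> 0 /\
                 shifted_poly b al 0 y = P y / hat_den s 0 y).
  { intros y; unfold hat_den; rewrite Rmult_0_l, Rminus_0_r, pow1.
    split; [lra|]. rewrite <- HPal; field. }
  assert (Htow : forall x, smooth_tower (shifted_poly b al) x 1)
    by (intros x k y _; apply is_derive_shifted_poly).
  apply (in_Pi_2_tower s s P (hat_den s 0) _ 1 Rlt_0_1 (Htow 0) (fun y _ => HQ y)) in HPi.
  destruct HPi as [_ [_ [O0 [O1 _]]]].
  assert (Hnn : forall k, 0 <= shifted_poly b al k (- b)).
  { intros k; apply nonneg_left_endpoint; [unfold b; lra| |].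
    - apply smooth_tower_continuous with 1; [lra|apply Htow].
    - intros x Hx.
      apply (abs_mono_at_tower P (hat_den s 0) _ x 1 Rlt_0_1 (Htow x) (fun y _ => HQ y)).
      apply Hmono, Hx. }
  pose proof (Hnn 0%nat) as N0; pose proof (Hnn 1%nat) as N1; pose proof (Hnn 2%nat) as N2.
  pose proof (Hnn 3%nat) as N3; pose proof (Hnn 4%nat) as N4.
  clear Hnn Hmono HQ Htow HPal.
  unfold shifted_poly in *; rewrite ?Rplus_opp_l in *; simpl in *.
  assert (Hb : 0 < b) by (unfold b; lra).
  (* The products [al_i b^i] are the probabilities: [E0] is their total mass and [E1] their mean. *)
  assert (B1 : 0 <= al 1%nat * b) by (apply Rmult_le_pos; lra).
  assert (B2 : 0 <= al 2%nat * b ^ 2) by (apply Rmult_le_pos; [lra|apply pow_le; lra]).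
  assert (B3 : 0 <= al 3%nat * b ^ 3) by (apply Rmult_le_pos; [lra|apply pow_le; lra]).
  assert (B4 : 0 <= al 4%nat * b ^ 4) by (apply Rmult_le_pos; [lra|apply pow_le; lra]).
  assert (E0 : al 0%nat + al 1%nat * b + al 2%nat * b ^ 2 + al 3%nat * b ^ 3
               + al 4%nat * b ^ 4 = 1) by (rewrite <- O0; ring).
  assert (E1 : al 1%nat * b + 2 * (al 2%nat * b ^ 2) + 3 * (al 3%nat * b ^ 3)
               + 4 * (al 4%nat * b ^ 4) = b).
  { replace b with (b * 1) at 5 by ring. rewrite <- O1; ring. }
  assert (Hbs : b = 2 * INR s) by reflexivity. clearbody b.
  destruct s as [|[|[|[|[|s]]]]]; try lia; simpl INR in Hbs;
    rewrite ?(Hal 2%nat), ?(Hal 3%nat), ?(Hal 4%nat) in * by lia; lra.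
Qed.

(* Coefficients of [(2 u - 1)^s]. *)
Definition star_coeff (s j : nat) : R :=
  nth j (match s with
         | 1%nat => [-1; 2]
         | 2%nat => [1; -4; 4]
         | 3%nat => [-1; 6; -12; 8]
         | _ => [1; -8; 24; -32; 16]
         end) 0.

(** * Positive poles and rigidity *)

Lemma positive_pole_rigidity (s : nat) (a : R) (c : nat -> R) :
  (1 <= s <= 4)%nat -> 0 < a -> (forall j, (s < j)%nat -> c j = 0) ->
  order2 a c -> (forall x, - (2 * INR s) < x <= 0 -> forall k, 0 <= pfrac a c k x) ->
  a = / (2 * INR s) /\ forall j, (j <= 4)%nat -> c j = star_coeff s j.
Proof.
  intros Hs Ha Hc Hord Hnn.
  assert (Hs1 : 1 <= INR s) by (apply (le_INR 1); lia).
  (* The point [rho] stays free so that [theta] can be tuned later. The last clause records the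
     weights at [theta = 1], where [q] and [/ (1 + theta)] are both 1/2. *)
  assert (Hmix : forall rho, 0 < rho <= 2 * INR s -> exists e1 e2 e3 e4,
     mixture (a * rho) rho e1 e2 e3 e4 /\
     ((s < 2)%nat -> e2 = 0) /\ ((s < 3)%nat -> e3 = 0) /\ ((s < 4)%nat -> e4 = 0) /\
     (a * rho = 1 ->
        e1 = / 2 * c 1%nat + / 2 * c 2%nat + 3 / 8 * c 3%nat + / 4 * c 4%nat /\
        e2 = / 4 * c 2%nat + 3 / 8 * c 3%nat + 3 / 8 * c 4%nat /\
        e3 = / 8 * c 3%nat + / 4 * c 4%nat /\ e4 = / 16 * c 4%nat)).
  { intros rho Hrho.
    assert (Hpos : forall k, 0 <= pfrac a c k (- rho)).
    { assert (Hw : 0 < 1 - a * - rho) by nra.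
      intros k; destruct (pfrac_tower a c (- rho) Hw) as [eps [He [Ht _]]].
      apply nonneg_left_endpoint; [lra| |intros x Hx; apply Hnn; lra].
      apply smooth_tower_continuous with eps; assumption. }
    do 4 eexists; split;
      [exact (mixture_of_pfrac a rho c _ Ha (proj1 Hrho) eq_refl Hord Hpos)|].
    split; [|split; [|split]]; intros H.
    - rewrite (Hc 2%nat), (Hc 3%nat), (Hc 4%nat) by lia; ring.
    - rewrite (Hc 3%nat), (Hc 4%nat) by lia; ring.
    - rewrite (Hc 4%nat) by lia; ring.
    - rewrite H; repeat split; field. }
  assert (Ht0 : 0 < a * (2 * INR s)) by (apply Rmult_lt_0_compat; lra).
  destruct (Hmix (2 * INR s) ltac:(lra)) as [e1 [e2 [e3 [e4 [Hm [Z2 [Z3 [Z4 Heq]]]]]]]].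
  pose proof (mixture_theta_ge1 s _ _ _ _ _ Hs Ht0 Hm Z2 Z3 Z4) as Hge.
  destruct (Req_dec (a * (2 * INR s)) 1) as [H1|Hne].
  - split.
    { apply Rmult_eq_reg_r with (2 * INR s); [|lra]. rewrite H1; field; lra. }
    (* The weights are triangular in [c 1, ..., c 4], which are recovered from them; [c 0] follows
       from [psi(0) = 1]. *)
    specialize (Heq H1); rewrite H1 in Hm; clear Hmix Hnn Hge.
    pose proof (mixture_theta_eq1 s _ _ _ _ Hs Hm Z2 Z3 Z4) as He.
    destruct Hord as [O0 _]; destruct (pfrac_order_values a c) as [E0 _].
    rewrite E0 in O0; clear E0.
    destruct s as [|[|[|[|[|s]]]]]; try lia;
      rewrite ?(Hc 2%nat), ?(Hc 3%nat), ?(Hc 4%nat) in * by lia;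
      intros j Hj; do 5 (destruct j as [|j];
        [rewrite ?(Hc 2%nat), ?(Hc 3%nat), ?(Hc 4%nat) by lia; unfold star_coeff; simpl; lra|]);
      lia.
  - exfalso; assert (Hgt : 1 < a * (2 * INR s)) by lra; clear Hne Hge Heq.
    destruct s as [|[|[|[|[|s]]]]]; try lia.
    + rewrite Z2, Z3, Z4 in Hm by lia; simpl INR in *.
      replace (2 * 1) with 2 in * by ring.
      pose proof (mixture_degree1 _ _ Ht0 Hm); lra.
    + rewrite Z3, Z4 in Hm by lia; simpl INR in *.
      replace (2 * (1 + 1)) with 4 in * by ring.
      exact (mixture_degree2 _ _ _ Hgt Hm).
    + rewrite Z4 in Hm by lia; simpl INR in *.
      replace (2 * (1 + 1 + 1)) with 6 in * by ring.
      destruct (Rle_lt_dec (a * 6) 5) as [H5|H5].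
      * exact (mixture_degree3 _ _ _ _ (conj Hgt H5) Hm).
      (* The choice [rho = 5 / a] makes [theta] equal to 5 and stays admissible because
         [6 a > 5]. *)
      * assert (Hr : 0 < 5 / a < 6).
        { split; [apply Rdiv_lt_0_compat; lra|].
          apply Rmult_lt_reg_l with a; [lra|]. replace (a * (5 / a)) with 5 by (field; lra); lra. }
        destruct (Hmix (5 / a) ltac:(lra)) as [f1 [f2 [f3 [f4 [Hm' [_ [_ [Y4 _]]]]]]]].
        rewrite Y4 in Hm' by lia.
        replace (a * (5 / a)) with 5 in Hm' by (field; lra).
        exact (mixture_degree3_large _ _ _ _ Hr Hm').
    + simpl INR in *.
      replace (2 * (1 + 1 + 1 + 1)) with 8 in * by ring.
      destruct (Rle_lt_dec (a * 8) 3) as [H5|H5].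
      * exact (mixture_degree4 _ _ _ _ _ (conj Hgt H5) Hm).
      * assert (Hr : 0 < 3 / a < 8).
        { split; [apply Rdiv_lt_0_compat; lra|].
          apply Rmult_lt_reg_l with a; [lra|]. replace (a * (3 / a)) with 3 by (field; lra); lra. }
        destruct (Hmix (3 / a) ltac:(lra)) as [f1 [f2 [f3 [f4 [Hm' _]]]]].
        replace (a * (3 / a)) with 3 in Hm' by (field; lra).
        exact (mixture_degree4_large _ _ _ _ _ Hr Hm').
Qed.

(** The interval omits [- 2 s], so that a radius equal to [2 s] suffices without knowing that the
    supremum is attained. *)
Lemma rigidity (s : nat) (P : R -> R) (a : R) :
  (1 <= s <= 4)%nat -> in_Pihat s s 2 P a ->
  (forall x, - (2 * INR s) < x <= 0 -> abs_mono_at P (hat_den s a) x) ->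
  a = / (2 * INR s) /\
  forall z, 1 - a * z <> 0 -> P z / hat_den s a z = pfrac a (star_coeff s) 0 z.
Proof.
  intros Hs HPi Hmono.
  assert (Hs1 : 1 <= INR s) by (apply (le_INR 1); lia).
  destruct (Req_dec a 0) as [->|Ha0];
    [destruct (polynomial_radius s P Hs HPi Hmono)|].
  destruct HPi as [HP HPi].
  destruct (partial_fractions s P a ltac:(lia) Ha0 HP) as [c [Hc HPc]].
  apply (in_Pi_pfrac s s P a c HPc) in HPi; destruct HPi as [_ [_ Hord]].
  destruct (Rlt_le_dec a 0) as [Han|Hap].
  - destruct (negative_pole_not_abs_mono a c Han Hord).
    apply (abs_mono_at_pfrac s P a c 0 HPc); [lra|apply Hmono; lra].
  - destruct (positive_pole_rigidity s a c Hs ltac:(lra) Hc Hord) as [Ha Hcs].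
    { intros x Hx; apply (abs_mono_at_pfrac s P a c x HPc); [nra|apply Hmono, Hx]. }
    split; [exact Ha|]; intros z Hz; rewrite HPc by exact Hz.
    unfold pfrac; apply sum_eq; intros i Hi; rewrite Hcs by exact Hi; reflexivity.
Qed.

(** * The extremal function *)

Lemma pfrac_star (s : nat) (z : R) :
  (1 <= s <= 4)%nat -> 1 - / (2 * INR s) * z <> 0 ->
  pfrac (/ (2 * INR s)) (star_coeff s) 0 z = psi_star s z.
Proof.
  intros Hs Hz.
  assert (Hs1 : 1 <= INR s) by (apply (le_INR 1); lia).
  unfold psi_star.
  replace (1 + z / (2 * INR s)) with (2 - (1 - / (2 * INR s) * z)) by (field; lra).
  replace (1 - z / (2 * INR s)) with (1 - / (2 * INR s) * z) by (field; lra).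
  unfold pfrac; set (w := 1 - / (2 * INR s) * z) in *; clearbody w.
  destruct s as [|[|[|[|[|s]]]]]; try lia; unfold star_coeff; simpl; field; assumption.
Qed.

Definition star_num (s : nat) (z : R) : R := (1 + / (2 * INR s) * z) ^ s.

Lemma star_frac (s : nat) (z : R) :
  (1 <= s <= 4)%nat -> 1 - / (2 * INR s) * z <> 0 ->
  star_num s z / hat_den s (/ (2 * INR s)) z = pfrac (/ (2 * INR s)) (star_coeff s) 0 z.
Proof.
  intros Hs Hz; rewrite pfrac_star by assumption.
  assert (Hs1 : 1 <= INR s) by (apply (le_INR 1); lia).
  unfold star_num, hat_den, psi_star.
  replace (/ (2 * INR s) * z) with (z / (2 * INR s)) by (field; lra). reflexivity.
Qed.

Lemma linear_power_deg_le (s : nat) (b : R) :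
  (1 <= s <= 4)%nat -> poly_deg_le s (fun z => (1 + b * z) ^ s).
Proof.
  intros Hs; destruct s as [|[|[|[|[|s]]]]]; try lia.
  - exists [1; b]; split; [simpl; lia|]; intros x; simpl; ring.
  - exists [1; 2 * b; b ^ 2]; split; [simpl; lia|]; intros x; simpl; ring.
  - exists [1; 3 * b; 3 * b ^ 2; b ^ 3]; split; [simpl; lia|]; intros x; simpl; ring.
  - exists [1; 4 * b; 6 * b ^ 2; 4 * b ^ 3; b ^ 4]; split; [simpl; lia|];
      intros x; simpl; ring.
Qed.

Lemma star_order2 (s : nat) :
  (1 <= s <= 4)%nat -> order2 (/ (2 * INR s)) (star_coeff s).
Proof.
  intros Hs; unfold order2.
  destruct (pfrac_order_values (/ (2 * INR s)) (star_coeff s)) as [-> [-> ->]].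
  destruct s as [|[|[|[|[|s]]]]]; try lia; unfold star_coeff; simpl;
    repeat split; field.
Qed.

Lemma star_in_Pihat (s : nat) :
  (1 <= s <= 4)%nat -> in_Pihat s s 2 (star_num s) (/ (2 * INR s)).
Proof.
  intros Hs; pose proof (linear_power_deg_le s (/ (2 * INR s)) Hs) as HP.
  split; [exact HP|].
  apply (in_Pi_pfrac s s _ _ (star_coeff s) (fun z => star_frac s z Hs)).
  split; [exact HP|split; [|apply star_order2, Hs]].
  destruct (linear_power_deg_le s (- / (2 * INR s)) Hs) as [l [Hl Hx]].
  exists l; split; [exact Hl|]; intros x; rewrite <- Hx; unfold hat_den; f_equal; ring.
Qed.

Lemma falling_product_nonneg (k : nat) :
  0 <= INR k * (INR k - 1) /\ 0 <= INR k * (INR k - 1) * (INR k - 2).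
Proof.
  destruct k as [|[|k]]; [simpl; lra|simpl; lra|].
  rewrite !S_INR; pose proof (pos_INR k).
  replace (INR k + 1 + 1 - 1) with (INR k + 1) by ring.
  replace (INR k + 1 + 1 - 2) with (INR k) by ring.
  split; repeat apply Rmult_le_pos; lra.
Qed.

(* With [2 u = 1 + t], expand [psi = (2/(1 - a z) - 1)^s] in powers of [t]:
   all coefficients are nonnegative combinations of binomials in [k]. *)
Lemma star_abs_mono (s : nat) (x : R) :
  (1 <= s <= 4)%nat -> - (2 * INR s) <= x <= 0 ->
  abs_mono_at (star_num s) (hat_den s (/ (2 * INR s))) x.
Proof.
  intros Hs Hx.
  assert (Hs1 : 1 <= INR s) by (apply (le_INR 1); lia).
  set (a := / (2 * INR s)).
  assert (Ha : 0 < a) by (apply Rinv_0_lt_compat; lra).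
  assert (Has : a * (2 * INR s) = 1) by (unfold a; field; lra).
  assert (Hw : 1 <= 1 - a * x <= 2) by nra.
  apply (abs_mono_at_pfrac s _ a (star_coeff s) x (fun z => star_frac s z Hs)); [lra|].
  set (t := 2 * / (1 - a * x) - 1).
  assert (Hu : / (1 - a * x) = (1 + t) / 2) by (unfold t; field; lra).
  assert (Ht : 0 <= t).
  { assert (/ 2 <= / (1 - a * x)) by (apply Rinv_le_contravar; lra). unfold t; lra. }
  clearbody t.
  assert (T2 : 0 <= t ^ 2) by (apply pow_le, Ht).
  assert (T3 : 0 <= t ^ 3) by (apply pow_le, Ht).
  assert (T4 : 0 <= t ^ 4) by (apply pow_le, Ht).
  intros [|k].
  - unfold pfrac; rewrite Hu.
    replace (sum_f_R0 _ 4) with (t ^ s); [apply pow_le, Ht|].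
    destruct s as [|[|[|[|[|s]]]]]; try lia; unfold star_coeff; simpl; field.
  - rewrite (pfrac_succ a _ k x _ (eq_sym Hu)).
    apply Rmult_le_pos.
    { apply Rmult_le_pos; [apply pos_INR|apply pow_le, Rmult_le_pos; lra]. }
    pose proof (pos_INR k) as K1; destruct (falling_product_nonneg k) as [K2 K3].
    assert (U1 : 0 <= 1 + t) by lra.
    set (n := INR k) in *; clearbody n.
    destruct s as [|[|[|[|[|s]]]]]; try lia; unfold star_coeff; cbn [nth].
    + lra.
    + replace (_ + _) with (2 * t * (1 + t) + (1 + t) ^ 2 * n) by field.
      apply Rplus_le_le_0_compat; repeat apply Rmult_le_pos; try lra; apply pow_le, U1.
    + replace (_ + _) with (3 * t ^ 2 * (1 + t) + 3 * t * (1 + t) ^ 2 * n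
         + (1 + t) ^ 3 * (n * (n - 1)) * / 2) by field.
      set (m := n * (n - 1)) in *; clearbody m.
      repeat apply Rplus_le_le_0_compat; repeat apply Rmult_le_pos;
        try lra; apply pow_le, U1.
    + replace (_ + _) with (4 * t ^ 3 * (1 + t) + 6 * t ^ 2 * (1 + t) ^ 2 * n
         + 4 * t * (1 + t) ^ 3 * (n * (n - 1)) * / 2
         + (1 + t) ^ 4 * (n * (n - 1) * (n - 2)) * / 6) by field.
      set (l := n * (n - 1) * (n - 2)) in *; clearbody l.
      set (m := n * (n - 1)) in *; clearbody m.
      repeat apply Rplus_le_le_0_compat; repeat apply Rmult_le_pos;
        try lra; apply pow_le, U1.
Qed.

(* Beyond [- 2 s] the base [2 u - 1] is negative, hence so is [psi] for [s] odd
   and [psi'] for [s] even. *)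
Lemma star_not_abs_mono (s : nat) (P : R -> R) (r : R) :
  (1 <= s <= 4)%nat -> 2 * INR s < r ->
  (forall z, 1 - / (2 * INR s) * z <> 0 ->
     P z / hat_den s (/ (2 * INR s)) z = pfrac (/ (2 * INR s)) (star_coeff s) 0 z) ->
  ~ abs_mono_at P (hat_den s (/ (2 * INR s))) (- r).
Proof.
  intros Hs Hr HP Habs.
  assert (Hs1 : 1 <= INR s) by (apply (le_INR 1); lia).
  set (a := / (2 * INR s)) in *.
  assert (Ha : 0 < a) by (apply Rinv_0_lt_compat; lra).
  assert (Has : a * (2 * INR s) = 1) by (unfold a; field; lra).
  assert (Hw : 2 < 1 - a * - r) by nra.
  assert (Hnn : forall k, 0 <= pfrac a (star_coeff s) k (- r)).
  { apply (abs_mono_at_pfrac s P a _ (- r) HP); [lra|exact Habs]. }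
  pose proof (Hnn 0%nat) as N0; pose proof (Hnn 1%nat) as N1.
  unfold pfrac in N0, N1; clear Hnn Habs HP.
  assert (Hu0 : 0 < / (1 - a * - r)) by (apply Rinv_0_lt_compat; lra).
  assert (Hu1 : / (1 - a * - r) < / 2) by (apply Rinv_lt_contravar; lra).
  set (u := / (1 - a * - r)) in *; clearbody u a.
  set (v := 1 - 2 * u).
  assert (Hv : 0 < v) by (unfold v; lra).
  assert (V3 : 0 < v ^ 3) by (apply pow_lt, Hv).
  assert (Hau : 0 < a * u ^ 2) by (apply Rmult_lt_0_compat; [lra|apply pow_lt, Hu0]).
  assert (Hav : 0 < a * u ^ 2 * v) by (apply Rmult_lt_0_compat; assumption).
  assert (Hav3 : 0 < a * u ^ 2 * v ^ 3) by (apply Rmult_lt_0_compat; assumption).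
  destruct s as [|[|[|[|[|s]]]]]; try lia; unfold star_coeff in *; simpl in N0, N1;
    unfold v in *; lra.
Qed.

(** * The supremum and uniqueness *)

(** A larger [r] would force [psi] to be the extremal function by rigidity, and that function fails
    at [- r]. *)
Lemma rad_set_le (s : nat) (P : R -> R) (a r : R) :
  (1 <= s <= 4)%nat -> in_Pihat s s 2 P a -> rad_set P (hat_den s a) r -> r <= 2 * INR s.
Proof.
  intros Hs HPi [->|[Hr Hmono]]; [pose proof (pos_INR s); lra|].
  apply Rnot_lt_le; intros Hlt.
  destruct (rigidity s P a Hs HPi) as [-> HP]; [intros x Hx; apply Hmono; lra|].
  apply (star_not_abs_mono s P r Hs Hlt HP), Hmono; lra.
Qed.

Lemma star_rad_set (s : nat) :
  (1 <= s <= 4)%nat -> rad_set (star_num s) (hat_den s (/ (2 * INR s))) (2 * INR s).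
Proof.
  intros Hs; right; split; [pose proof (pos_INR s); lra|].
  intros x Hx; apply star_abs_mono; assumption.
Qed.

Lemma agrees_star_of_pfrac (s : nat) (P : R -> R) :
  (1 <= s <= 4)%nat ->
  (forall z, 1 - / (2 * INR s) * z <> 0 ->
     P z / hat_den s (/ (2 * INR s)) z = pfrac (/ (2 * INR s)) (star_coeff s) 0 z) ->
  agrees_star s P (hat_den s (/ (2 * INR s))).
Proof.
  intros Hs HP z _ Hz.
  assert (Hs1 : 1 <= INR s) by (apply (le_INR 1); lia).
  replace (z / (2 * INR s)) with (/ (2 * INR s) * z) in Hz by (field; lra).
  rewrite HP, pfrac_star by assumption; reflexivity.
Qed.

Theorem theorem2p2 (s : nat) (Hs : (1 <= s <= 4)%nat) :
  hatR_is s s 2 (2 * INR s) /\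
  (exists P a, in_Pihat s s 2 P a /\ radius_is P (hat_den s a) (2 * INR s) /\
               agrees_star s P (hat_den s a)) /\
  (forall P a, in_Pihat s s 2 P a -> radius_is P (hat_den s a) (2 * INR s) ->
               agrees_star s P (hat_den s a)).
Proof.
  pose proof (star_in_Pihat s Hs) as Hin.
  pose proof (star_rad_set s Hs) as Hrad.
  split; [split|split].
  - intros r [P [a [HPi Hr]]]; exact (rad_set_le s P a r Hs HPi Hr).
  - intros b Hb; apply Hb; do 2 eexists; split; [exact Hin|exact Hrad].
  - exists (star_num s), (/ (2 * INR s)); split; [exact Hin|split; [split|]].
    + intros r Hr; exact (rad_set_le s _ _ r Hs Hin Hr).
    + intros b Hb; apply Hb, Hrad.
    + apply agrees_star_of_pfrac; [exact Hs|intros z; apply star_frac, Hs].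
  - intros P a HPi [_ Hlub].
    destruct (rigidity s P a Hs HPi) as [-> HP].
    + intros x Hx.
      (* Some element of the set exceeds [- x]; otherwise [- x < 2 s] would be an upper bound below
         the least one. *)
      destruct (Classical_Prop.classic (exists r, rad_set P (hat_den s a) r /\ - x < r))
        as [[r [[->|[Hr Hmono]] Hxr]]|Hno].
      * lra.
      * apply Hmono; lra.
      * exfalso; enough (2 * INR s <= - x) by lra.
        apply Hlub; intros r Hr; apply Rnot_lt_le; intros Hlt; apply Hno; eauto.
    + apply agrees_star_of_pfrac; assumption.
Qed.
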